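(* Let $a<b$ be coprime positive integers and let $c\in\mathbb{Z}$. Consider the set $$T=\{(y_1,y_2)\in\mathbb{Z}_{\geq 0}^2 \;|\; a y_1+b y_2\leq c\}.$$ Then, with $k=\lfloor c/(ab)\rfloor$, $$\# T = -\frac{ab}{2}k^2+\frac{a+b+1+2c}{2}k+\sum_{i=0}^{\left\lfloor \frac{c-kab}{b}\right\rfloor}\left(\left\lfloor \frac{c-kab-ib}{a}\right\rfloor+1\right).$$ Equivalently, writing the Euclidean division $c=q\cdot ab+r$ with $0\le r<ab$, $$\# T = -\frac{ab}{2}q^2+\frac{a+b+1+2c}{2}q+\sum_{i=0}^{\lfloor r/b\rfloor}\left(\left\lfloor \frac{r-ib}{a}\right\rfloor+1\right).$$
   Context: $\lfloor\cdot\rfloor$ denotes the floor function and $\# $ denotes cardinality.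
   Formalization: The formula is proved for integers c ≥ -(a+b) rather than all integers c; for every c < -(a+b) it fails, e.g. a=1, b=2, c=-4 gives #T=0 but right-hand side 1. *)

(* Defs.v *)
From HB Require Import structures.
From mathcomp Require Import all_boot all_order all_algebra.
From mathcomp Require Import finmap.
From mathcomp Require Import all_classical.

Set Implicit Arguments.
Unset Strict Implicit.
Unset Printing Implicit Defensive.

Import Order.TTheory GRing.Theory Num.Theory.

Local Open Scope classical_set_scope.
Local Open Scope ring_scope.

Definition lattice_triangle (a b : nat) (c : int) : set (nat * nat) :=
  [set y | a%:Z * y.1%:Z + b%:Z * y.2%:Z <= c].

Definition floor_div (m n : int) : int := Num.floor (m%:~R / n%:~R : rat).

(* The right-hand side for c = q * a * b + r. It is only used with 0 <= r and
   0 < b, so that floor (r / b) >= 0 and taking [absz] of the upper summation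
   bound merely converts it to [nat]. *)
Definition triangle_count (a b : nat) (c q r : int) : rat :=
  - ((a%:R * b%:R) / 2%:R) * q%:~R ^+ 2
  + (a%:R + b%:R + 1 + 2%:R * c%:~R) / 2%:R * q%:~R
  + \sum_(0 <= i < `|floor_div r b%:Z|%N.+1)
      (floor_div (r - i%:Z * b%:Z) a%:Z + 1)%:~R.

(* Main.v *)
(** Splitting off the rows [y_2 < a] of the triangle of size [c + ab] leaves a
    translate of the triangle of size [c].  By coprimality the residues of
    [c + ab - ib] modulo [a] for [i < a] run through all of [0, ..., a - 1], so
    these rows contain exactly [c + (a + 1)(b + 1) / 2] points; this needs only
    that [floor (x / a) + 1] is the true (nonnegative) length of each of these
    rows, which is where [c >= - (a + b)] enters.  The right-hand side satisfies the same recurrence in [q]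
    and both sides agree for [q = 0], so induction in both directions on [q]
    concludes. *)
Require Import Defs.
From HB Require Import structures.
From mathcomp Require Import all_boot all_order all_algebra.
From mathcomp Require Import finmap.
From mathcomp Require Import all_classical.
From mathcomp Require Import zify ring lra.

Set Implicit Arguments.
Unset Strict Implicit.
Unset Printing Implicit Defensive.

Import Order.TTheory GRing.Theory Num.Theory.

Local Open Scope classical_set_scope.
Local Open Scope ring_scope.

Lemma floor_divE (m n : int) : 0 < n -> floor_div m n = (m %/ n)%Z.
Proof.
move=> n0; rewrite /floor_div; apply: floor_def.
have n0Q : 0 < n%:~R :> rat by rewrite ltr0z.
rewrite ler_pdivlMr // ltr_pdivrMr // -!intrM ler_int ltr_int.
by rewrite lez_floor ?gt_eqF //= ltz_ceil.
Qed.

(** Number of naturals [i] with [a * i <= x]. Negative [x] is split off because floor (x / a) + 1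
    becomes negative once [x < - a], whereas the row is merely empty. *)
Definition row_length (a : nat) (x : int) : nat :=
  if 0 <= x then `|(x %/ a%:Z)%Z|.+1 else 0%N.

Lemma row_lengthE (a : nat) (x : int) : (0 < a)%N -> - a%:Z <= x ->
  (row_length a x)%:Z = (x %/ a%:Z)%Z + 1.
Proof.
move=> a0 ax; rewrite /row_length; case: ifP => [x0|/negbT].
  by rewrite -addn1 PoszD gez0_abs // divz_ge0 ?ltz_nat.
rewrite -ltNge => x0.
(* Since [- a <= x < 0], the quotient is exactly -1, so the formula still gives an empty row length
   0. *)
suff -> : (x %/ a%:Z)%Z = -1 by [].
have := divz_eq x a%:Z; have := modz_ge0 x (d := a%:Z).
have := ltz_pmod x (d := a%:Z).
set q := (x %/ _)%Z; set r := (x %% _)%Z; nia.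
Qed.

Lemma row_lengthP (a : nat) (x : int) (i : nat) : (0 < a)%N ->
  (i < row_length a x)%N = (a%:Z * i%:Z <= x).
Proof.
move=> a0; rewrite /row_length; case: ifP => x0; last first.
  by apply/esym/negbTE; move/negbT: x0; rewrite -!ltNge; nia.
have q0 : 0 <= (x %/ a%:Z)%Z by rewrite divz_ge0 ?ltz_nat.
by rewrite ltnS -lez_nat gez0_abs // lez_divRL ?ltz_nat // mulrC.
Qed.

(** Counting row by row: [c < m * b] forces [y.2 < m]. Any such [m] is allowed, as surplus rows have
    length 0; this lets later proofs choose the number of rows freely. *)
Lemma lattice_triangle_card (a b : nat) (c : int) (m : nat) :
  (0 < a)%N -> c < m%:Z * b%:Z ->
  finite_set (lattice_triangle a b c) /\
  (#|` fset_set (lattice_triangle a b c)| =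
    \sum_(0 <= j < m) row_length a (c - j%:Z * b%:Z))%N.
Proof.
move=> a0 cm.
pose s := [seq (i, j) | j <- iota 0 m,
                        i <- iota 0 (row_length a (c - j%:Z * b%:Z))].
have sE : lattice_triangle a b c = [set` [fset y in s]%fset].
  apply/seteqP; split => -[i j]; rewrite /lattice_triangle /= inE /=.
    move=> ijc; apply/allpairsPdep; exists j, i.
    rewrite !mem_iota /= !add0n row_lengthP //; split=> //; nia.
  case/allpairsPdep => j' [i'] [_]; rewrite mem_iota add0n row_lengthP //.
  by move=> /= h [-> ->]; nia.
rewrite sE; split; first exact: finite_fset.
rewrite set_fsetK card_fseq undup_id; last first.
  apply: allpairs_uniq_dep => [|j _|]; try exact: iota_uniq.
  by move=> [j i] [j' i'] _ _ /= [-> ->].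
rewrite size_allpairs_dep sumnE big_map /index_iota subn0.
by apply: eq_bigr => j _; rewrite size_iota.
Qed.

(** As [b] is invertible modulo [a], the map sending [i] to the residue of [x - i * b] is injective
    on ['I_a], hence a permutation of it. *)
Lemma sum_modz_coprime (a b : nat) (x : int) : (0 < a)%N -> coprime a b ->
  \sum_(0 <= i < a) ((x - i%:Z * b%:Z) %% a%:Z)%Z = \sum_(0 <= i < a) i%:Z.
Proof.
case: a => // a _ co_ab; rewrite !big_mkord.
pose res (i : 'I_a.+1) := ((x - i%:Z * b%:Z) %% a.+1%:Z)%Z.
have res_ge0 i : 0 <= res i by apply: modz_ge0.
have res_lt i : (`|res i| < a.+1)%N.
  by rewrite -ltz_nat gez0_abs // ltz_pmod.
pose f i := Ordinal (res_lt i).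
have f_inj : injective f.
  move=> i j /(congr1 val) /= /(congr1 Posz); rewrite !gez0_abs // => /eqP.
  rewrite eqz_mod_dvd.
  have -> : x - i%:Z * b%:Z - (x - j%:Z * b%:Z) = (j%:Z - i%:Z) * b%:Z by ring.
  rewrite Gauss_dvdzl // => /dvdzP[k jik].
  apply/val_inj => /=; move: (ltn_ord i) (ltn_ord j) jik.
  (* Here [j - i] is [k] times the modulus, while both indices lie below the modulus, so only
     [k = 0] survives. *)
  have [k1 | [k1 | ->]] : k <= -1 \/ 1 <= k \/ k = 0 by lia.
  - nia.
  - nia.
  - lia.
rewrite [RHS](reindex_inj f_inj).
by apply: eq_bigr => i _; rewrite /= gez0_abs.
Qed.

Lemma sum_posz (n : nat) : 2 * (\sum_(0 <= i < n) i%:Z) = n%:Z * (n%:Z - 1).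
Proof.
elim: n => [|n IHn]; first by rewrite big_nil.
by rewrite big_nat_recr //= mulrDr IHn; lia.
Qed.

(** Sum the Euclidean divisions of [x - i * b] by [a]: the remainders are known in total, which
    determines [a] times the sum of the quotients. The factor 2 keeps the identity in the
    integers. *)
Lemma sum_divz_coprime (a b : nat) (x : int) : (0 < a)%N -> coprime a b ->
  2 * (\sum_(0 <= i < a) ((x - i%:Z * b%:Z) %/ a%:Z)%Z) =
    2 * x - (a%:Z - 1) * (b%:Z + 1).
Proof.
move=> a0 co_ab.
have a0Z : a%:Z != 0 by lia.
apply: (mulIf a0Z).
have xE : \sum_(0 <= i < a) (x - i%:Z * b%:Z) =
    (\sum_(0 <= i < a) ((x - i%:Z * b%:Z) %/ a%:Z)%Z) * a%:Z
    + \sum_(0 <= i < a) i%:Z.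
  rewrite -(sum_modz_coprime x a0 co_ab) mulr_suml -big_split /=.
  by apply: eq_bigr => i _; exact: divz_eq.
move: xE (sum_posz a); rewrite sumrB -mulr_suml sumr_const_nat subn0.
rewrite -(mulr_natr x) natz.
set S := \sum_(0 <= i < a) i%:Z; set D := \sum_(0 <= i < a) _ => xE SE.
have -> : 2 * D * a%:Z = 2 * (D * a%:Z) by ring.
have -> : D * a%:Z = x * a%:Z - S * b%:Z - S by rewrite xE addrK.
rewrite (_ : 2 * _ = 2 * x * a%:Z - (2 * S) * (b%:Z + 1)); last by ring.
by rewrite SE; ring.
Qed.

Definition triangle_card (a b : nat) (c : int) : nat :=
  #|` fset_set (lattice_triangle a b c)|%fset.

Lemma lt_mul_absz (b : nat) (c : int) : (0 < b)%N -> c < `|c|.+1%:Z * b%:Z.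
Proof. nia. Qed.

Lemma triangle_card_shift (a b : nat) (c : int) :
  (0 < a)%N -> (0 < b)%N -> coprime a b -> - (a%:Z + b%:Z) <= c ->
  2 * (triangle_card a b (c + a%:Z * b%:Z))%:Z =
  2 * (triangle_card a b c)%:Z + 2 * c + (a%:Z + 1) * (b%:Z + 1).
Proof.
move=> a0 b0 co_ab c_ge; have cm := lt_mul_absz c b0.
set m := `|c|.+1 in cm.
have cm' : c + a%:Z * b%:Z < (a + m)%:Z * b%:Z by rewrite PoszD mulrDl; lia.
rewrite /triangle_card (lattice_triangle_card a0 cm).2.
rewrite (lattice_triangle_card a0 cm').2.
rewrite (@big_cat_nat _ _ _ a) ?leq_addr //=.
(* Row [j + a] of the large triangle is row [j] of the small one:
   [c + a * b - (j + a) * b = c - j * b]. *)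
rewrite -[X in index_iota X (a + m)]add0n big_addn addKn PoszD mulrDr addrC -addrA; congr (2 * _ + _).
  by congr Posz; apply: eq_bigr => j _; congr row_length; rewrite PoszD; ring.
rewrite (big_morph Posz PoszD (erefl _)).
rewrite (eq_big_nat _ _ (F2 := fun j =>
    ((c + a%:Z * b%:Z - j%:Z * b%:Z) %/ a%:Z)%Z + 1)); last first.
  (* For [j < a] the argument is at least [c + b], hence at least [- a] by the lower bound on
     [c]. *)
  by move=> j /= ja; rewrite row_lengthE //; nia.
rewrite big_split /= mulrDr sum_divz_coprime // sumr_const_nat subn0 natz.
by ring.
Qed.

Lemma triangle_card_base (a b : nat) (r : int) :
  (0 < a)%N -> (0 < b)%N -> 0 <= r ->
  (triangle_card a b r)%:R = triangle_count a b r 0 r.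
Proof.
move=> a0 b0 r0.
rewrite /triangle_count expr0n /= !mulr0 !add0r.
have b0Z : 0 < b%:Z by lia.
have a0Z : 0 < a%:Z by lia.
have q0 : 0 <= (r %/ b%:Z)%Z by rewrite divz_ge0.
rewrite floor_divE //.
have rm : r < `|(r %/ b%:Z)%Z|.+1%:Z * b%:Z.
  by rewrite -addn1 PoszD gez0_abs // ltz_ceil.
rewrite /triangle_card (lattice_triangle_card a0 rm).2 natr_sum.
(* For [j] up to floor (r / b) one has [r - j * b >= 0], so every summand is a true row length. *)
apply: eq_big_nat => j /=; rewrite ltnS -lez_nat gez0_abs // lez_divRL // => jr.
by rewrite floor_divE // -row_lengthE //; lia.
Qed.

(** The sum in [triangle_count] depends only on [a], [b] and [r], so it cancels and a polynomial
    identity remains. *)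
Lemma triangle_count_shift (a b : nat) (q r : int) :
  let c := q * (a%:Z * b%:Z) + r in
  triangle_count a b (c + a%:Z * b%:Z) (q + 1) r =
  triangle_count a b c q r + c%:~R + (a%:R + 1) * (b%:R + 1) / 2%:R.
Proof.
rewrite /triangle_count /=; set S := \sum_(_ <= _ < _) _.
rewrite !(intrD, intrM) -!pmulrn.
by field.
Qed.

Lemma triangle_card_count_step (a b : nat) (q r : int) :
  (0 < a)%N -> (0 < b)%N -> coprime a b ->
  let c := q * (a%:Z * b%:Z) + r in - (a%:Z + b%:Z) <= c ->
  (triangle_card a b c)%:R = triangle_count a b c q r <->
  (triangle_card a b (c + a%:Z * b%:Z))%:R =
    triangle_count a b (c + a%:Z * b%:Z) (q + 1) r.
Proof.
move=> a0 b0 co_ab c c_ge; rewrite triangle_count_shift -/c.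
have /(congr1 (fun z : int => z%:~R : rat)) := triangle_card_shift a0 b0 co_ab c_ge.
rewrite !(intrD, intrM) -!pmulrn => E.
by split=> E'; lra.
Qed.

Lemma triangle_card_count (a b : nat) (q r : int) :
  (0 < a)%N -> (0 < b)%N -> coprime a b -> 0 <= r ->
  let c := q * (a%:Z * b%:Z) + r in - (a%:Z + b%:Z) <= c ->
  (triangle_card a b c)%:R = triangle_count a b c q r.
Proof.
move=> a0 b0 co_ab r0 /=.
have step p := @triangle_card_count_step a b p r a0 b0 co_ab.
have next (p : int) : (p + 1) * (a%:Z * b%:Z) + r =
  p * (a%:Z * b%:Z) + r + a%:Z * b%:Z by ring.
have ab0 : 0 < a%:Z * b%:Z by rewrite mulr_gt0 // ltz_nat.
elim/int_rect: q => [_|n IHn _|n IHn c_ge].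
- by rewrite mul0r add0r; exact: triangle_card_base.
- have c_ge : - (a%:Z + b%:Z) <= n%:Z * (a%:Z * b%:Z) + r by nia.
  by rewrite -addn1 PoszD next; apply/(step _ c_ge)/IHn.
(* Downward induction: the step is read from [c + a * b] back to [c], and the larger value inherits
   the lower bound. *)
- apply/(step _ c_ge); rewrite -next.
  have -> : - n.+1%:Z + 1 = - n%:Z by lia.
  by apply: IHn; apply: le_trans c_ge _; nia.
Qed.

Theorem theorem1p2 (a b : nat) (c : int)
    (a_gt0 : (0 < a)%N) (a_lt_b : (a < b)%N) (co_ab : coprime a b)
    (c_ge : - (a%:Z + b%:Z) <= c) :
  let T := lattice_triangle a b c in
  let k := floor_div c (a%:Z * b%:Z) in
  [/\ finite_set T,
      (#|` fset_set T|%fset)%:R = triangle_count a b c k (c - k * a%:Z * b%:Z)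
    & forall q r : int,
        c = q * (a%:Z * b%:Z) + r -> 0 <= r < a%:Z * b%:Z ->
        (#|` fset_set T|%fset)%:R = triangle_count a b c q r].
Proof.
move=> T k.
have b_gt0 : (0 < b)%N by apply: leq_trans a_lt_b.
have ab0 : 0 < a%:Z * b%:Z by rewrite mulr_gt0 // ltz_nat.
have count (q r : int) : c = q * (a%:Z * b%:Z) + r -> 0 <= r ->
    (#|` fset_set T|%fset)%:R = triangle_count a b c q r.
  move=> cE r0; move: c_ge; rewrite /T cE.
  exact: triangle_card_count.
split; first exact: (lattice_triangle_card a_gt0 (lt_mul_absz c b_gt0)).1.
- apply: count; first by rewrite mulrA addrC subrK.
  by rewrite -mulrA /k floor_divE // subr_ge0 lez_floor ?gt_eqF.
- by move=> q r cE /andP[r0 _]; exact: count.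
Qed.
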